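(* Kleene's second model $\mathcal{K}_2$ and its effective version $\mathcal{K}_2^{\mathrm{eff}}$ are strongly completable: for each $\mathcal{A}\in\{\mathcal{K}_2,\mathcal{K}_2^{\mathrm{eff}}\}$ there exist a total combinatory algebra $\mathcal{B}$ and a strong embedding $f:\mathcal{A}\to\mathcal{B}$.
   Context: A partial combinatory algebra (pca) is a set $\mathcal{A}$ with more than one element together with a partial binary operation $(a,b)\mapsto ab$ (application, associating to the left; $ab\!\downarrow$ means defined) such that there exist $k,s\in\mathcal{A}$ (combinators) with, for all $a,b,c$: $ka\!\downarrow$ and $kab=a$; $sab\!\downarrow$ and $sabc\simeq ac(bc)$ (Kleene equality). A (total) combinatory algebra is a pca whose application is total. For pcas $\mathcal{A},\mathcal{B}$, an injection $f:\mathcal{A}\to\mathcal{B}$ is a weak embedding if for all $a,b\in\mathcal{A}$, $ab\!\downarrow$ in $\mathcal{A}$ implies $f(a)f(b)\!\downarrow$ in $\mathcal{B}$ and $f(a)f(b)=f(ab)$; it is a strong embedding if moreover, for some choice of combinators $k,s$ of $\mathcal{A}$, $f(k)$ and $f(s)$ serve as combinators $k,s$ for $\mathcal{B}$. Kleene's second model $\mathcal{K}_2$ is the pca on $\omega^\omega$ with application $\alpha\cdot\beta=\Phi_{\alpha(0)}^{\alpha\oplus\beta}$, where $\Phi_e$ is the $e$-th Turing functional, $(\alpha\oplus\beta)(2n)=\alpha(n)$, $(\alpha\oplus\beta)(2n+1)=\beta(n)$, and $\alpha\cdot\beta$ is defined iff $\Phi_{\alpha(0)}^{\alpha\oplus\beta}$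 is total. $\mathcal{K}_2^{\mathrm{eff}}$ is the restriction of $\mathcal{K}_2$ to computable elements of $\omega^\omega$. *)

(* Defs.v *)
From Stdlib Require Import Arith Lia Cantor.
From Stdlib Require Import FunctionalExtensionality ProofIrrelevance.

(* The partial application is given by its graph: [app a b c] reads
   "ab is defined and equal to c". *)
Record pas : Type := Pas {
  carrier :> Type;
  app : carrier -> carrier -> carrier -> Prop;
  app_functional : forall a b c c', app a b c -> app a b c' -> c = c'
}.

Arguments app {p} _ _ _.

Definition app_defined {A : pas} (a b : A) : Prop := exists c, app a b c.

Definition is_k {A : pas} (k : A) : Prop :=
  forall a, exists ka, app k a ka /\ forall b, app ka b a.

(* The last clause is the Kleene equality sabc = ac(bc): both sides have the
   same values d, the right-hand side being strict in ac and bc. *)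
Definition is_s {A : pas} (s : A) : Prop :=
  forall a b, exists sa sab, app s a sa /\ app sa b sab /\
    forall c d, app sab c d <->
      exists ac bc, app a c ac /\ app b c bc /\ app ac bc d.

Definition is_pca (A : pas) : Prop :=
  (exists a b : A, a <> b) /\ (exists k s : A, is_k k /\ is_s s).

Definition is_total_ca (A : pas) : Prop :=
  is_pca A /\ forall a b : A, app_defined a b.

Definition weak_embedding {A B : pas} (f : A -> B) : Prop :=
  (forall a a', f a = f a' -> a = a') /\
  (forall a b c : A, app a b c -> app (f a) (f b) (f c)).

Definition strong_embedding {A B : pas} (f : A -> B) : Prop :=
  weak_embedding f /\
  exists k s : A, is_k k /\ is_s s /\ is_k (f k) /\ is_s (f s).

Definition strongly_completable (A : pas) : Prop :=
  exists B : pas, is_total_ca B /\ exists f : A -> B, strong_embedding f.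

(* Kleene's presentation of the partial functions that are recursive in an
   oracle, as unary functions with several arguments packed by Cantor's
   pairing. *)

Definition pair_nat (x y : nat) : nat := Cantor.to_nat (x, y).
Definition left_nat (z : nat) : nat := fst (Cantor.of_nat z).
Definition right_nat (z : nat) : nat := snd (Cantor.of_nat z).

Inductive code : Type :=
  | Zero | Succ | Left | Right | Query
  | Pair (c d : code)
  | Comp (c d : code)
  | Prec (c d : code)
  | Mu (c : code).

(* [prec_graph g h n y]: y is the n-th value of the recursion that starts
   from the partial value g and has the partial step z |-> h i z. *)
Fixpoint prec_graph (g : nat -> Prop) (h : nat -> nat -> nat -> Prop)
    (n y : nat) : Prop :=
  match n with
  | 0 => g y
  | S i => exists z, prec_graph g h i z /\ h i z y
  end.

(* [eval f c x y]: the program c with oracle f halts on x with output y. *)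
Fixpoint eval (f : nat -> nat) (c : code) (x y : nat) : Prop :=
  match c with
  | Zero => y = 0
  | Succ => y = S x
  | Left => y = left_nat x
  | Right => y = right_nat x
  | Query => y = f x
  | Pair c1 c2 =>
      exists u v, eval f c1 x u /\ eval f c2 x v /\ y = pair_nat u v
  | Comp c1 c2 => exists u, eval f c2 x u /\ eval f c1 u y
  | Prec c1 c2 =>
      prec_graph (eval f c1 (left_nat x))
        (fun i z => eval f c2 (pair_nat (left_nat x) (pair_nat i z)))
        (right_nat x) y
  | Mu c1 =>
      eval f c1 (pair_nat x y) 0 /\
      forall m, m < y -> exists v, eval f c1 (pair_nat x m) (S v)
  end.

(* An index is a pair <tag, data>.  For tags >= 5 the data is smaller than the
   index, so that S e units of fuel suffice to decode e. *)
Fixpoint decode_fuel (fuel e : nat) : code :=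
  match fuel with
  | 0 => Zero
  | S k =>
      let r := right_nat e in
      let c := decode_fuel k (left_nat r) in
      let d := decode_fuel k (right_nat r) in
      match left_nat e with
      | 0 => Zero
      | 1 => Succ
      | 2 => Left
      | 3 => Right
      | 4 => Query
      | 5 => Pair c d
      | 6 => Comp c d
      | 7 => Prec c d
      | _ => Mu (decode_fuel k r)
      end
  end.

Definition decode (e : nat) : code := decode_fuel (S e) e.

(* [Phi e f x y]: the e-th functional with oracle f is defined at x, with
   value y. *)
Definition Phi (e : nat) (f : nat -> nat) (x y : nat) : Prop :=
  eval f (decode e) x y.

Fixpoint encode (c : code) : nat :=
  match c with
  | Zero => pair_nat 0 0
  | Succ => pair_nat 1 0
  | Left => pair_nat 2 0
  | Right => pair_nat 3 0
  | Query => pair_nat 4 0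
  | Pair c d => pair_nat 5 (pair_nat (encode c) (encode d))
  | Comp c d => pair_nat 6 (pair_nat (encode c) (encode d))
  | Prec c d => pair_nat 7 (pair_nat (encode c) (encode d))
  | Mu c => pair_nat 8 (encode c)
  end.

Lemma left_pair x y : left_nat (pair_nat x y) = x.
Proof. unfold left_nat, pair_nat; now rewrite Cantor.cancel_of_to. Qed.

Lemma right_pair x y : right_nat (pair_nat x y) = y.
Proof. unfold right_nat, pair_nat; now rewrite Cantor.cancel_of_to. Qed.

Lemma pair_ge x y : y + x <= pair_nat x y.
Proof. apply Cantor.to_nat_non_decreasing. Qed.

Lemma decode_fuel_encode c k : encode c < k -> decode_fuel k (encode c) = c.
Proof.
  revert k; induction c; intros [|k] Hk; try lia;
    cbn [encode] in *; cbn [decode_fuel]; rewrite ?right_pair, ?left_pair;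
    try reflexivity.
  1-3: match type of Hk with pair_nat ?t (pair_nat ?a ?b) < _ =>
         pose proof (pair_ge t (pair_nat a b)); pose proof (pair_ge a b) end;
       rewrite IHc1, IHc2 by lia; reflexivity.
  pose proof (pair_ge 8 (encode c)); rewrite IHc by lia; reflexivity.
Qed.

Lemma decode_encode c : decode (encode c) = c.
Proof. apply decode_fuel_encode; lia. Qed.

Lemma prec_graph_functional (g : nat -> Prop) (h : nat -> nat -> nat -> Prop) :
  (forall y y', g y -> g y' -> y = y') ->
  (forall i z y y', h i z y -> h i z y' -> y = y') ->
  forall n y y', prec_graph g h n y -> prec_graph g h n y' -> y = y'.
Proof.
  intros Hg Hh; induction n as [|n IH]; cbn; [exact Hg|].
  intros y y' (z & Hz & Hy) (z' & Hz' & Hy').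
  rewrite <- (IH _ _ Hz Hz') in Hy'; exact (Hh _ _ _ _ Hy Hy').
Qed.

Lemma eval_functional f c x y y' : eval f c x y -> eval f c x y' -> y = y'.
Proof.
  revert x y y'; induction c; cbn; intros x y y'; try congruence.
  - intros (u & v & Hu & Hv & ->) (u' & v' & Hu' & Hv' & ->).
    f_equal; eauto.
  - intros (u & Hu & Hy) (u' & Hu' & Hy').
    rewrite <- (IHc2 _ _ _ Hu Hu') in Hy'; eauto.
  - apply prec_graph_functional; eauto.
  - intros [H0 Hlt] [H0' Hlt'].
    destruct (Nat.lt_trichotomy y y') as [H|[H|H]]; [|exact H|].
    + destruct (Hlt' _ H) as [v Hv]; discriminate (IHc _ _ _ H0 Hv).
    + destruct (Hlt _ H) as [v Hv]; discriminate (IHc _ _ _ H0' Hv).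
Qed.

Definition join (alpha beta : nat -> nat) (n : nat) : nat :=
  if Nat.even n then alpha (Nat.div2 n) else beta (Nat.div2 n).

Definition K2_app (alpha beta gamma : nat -> nat) : Prop :=
  forall n, Phi (alpha 0) (join alpha beta) n (gamma n).

Lemma K2_app_functional alpha beta gamma gamma' :
  K2_app alpha beta gamma -> K2_app alpha beta gamma' -> gamma = gamma'.
Proof.
  intros H H'; apply functional_extensionality; intro n.
  exact (eval_functional _ _ _ _ _ (H n) (H' n)).
Qed.

Definition K2 : pas := Pas (nat -> nat) K2_app K2_app_functional.

Definition computable (alpha : nat -> nat) : Prop :=
  exists e, forall n, Phi e (fun _ => 0) n (alpha n).

Definition K2eff_app (alpha beta gamma : {a : nat -> nat | computable a}) :
    Prop :=
  K2_app (proj1_sig alpha) (proj1_sig beta) (proj1_sig gamma).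

Lemma K2eff_app_functional alpha beta gamma gamma' :
  K2eff_app alpha beta gamma -> K2eff_app alpha beta gamma' -> gamma = gamma'.
Proof.
  intros H H'.
  destruct gamma as [g Hg], gamma' as [g' Hg'].
  apply subset_eq_compat; exact (K2_app_functional _ _ _ _ H H').
Qed.

Definition K2eff : pas :=
  Pas {a : nat -> nat | computable a} K2eff_app K2eff_app_functional.

(* Main.v *)
(* A pca is strongly completable as soon as k and s can be chosen so that the
   head normal forms k, s, ka, sa, sab are pairwise distinct and determine a
   and b (Bethke, Klop and de Vrijer).  Closed terms over such a pca, reduced by
   its own application and by the k- and s-rules, have the Church-Rosser property
   and the elements of the pca as normal forms, so that convertibility classes
   are a total combinatory algebra into which the pca embeds.

   In Kleene's second model the value of an element at 0 is an index and the other
   values are free for data, so that ka, sa and sab can store a and b behind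
   pairwise distinct indices.  The index of sab has to run the program a(0), and
   then the program (ac)(0), which is only known after c; this takes a universal
   program, obtained as a stack machine with a primitive recursive step, and the
   relativization of programs to oracles that are themselves computed. *)

From Stdlib Require Import Arith Lia Cantor List.
From Stdlib Require Import PropExtensionality FunctionalExtensionality
  ProofIrrelevance ClassicalEpsilon.
From Stdlib Require Import Relations_1 Relations_2 Relations_3 Relations_2_facts
  Relations_3_facts.
Require Import Defs.
Import ListNotations.

(* The values k, s, ka, sa, sab are told apart by [rank], and they determine
   a and b (for ka this already follows from kab = a). *)
Record unique_hnf {A : pas} (k s : A) : Prop := UniqueHnf {
  hnf_is_k : is_k k;
  hnf_is_s : is_s s;
  hnf_rank : exists rank : A -> nat,
    rank k = 0 /\ rank s = 1 /\
    (forall a x, app k a x -> rank x = 2) /\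
    (forall a x, app s a x -> rank x = 3) /\
    (forall a b x y, app s a x -> app x b y -> rank y = 4);
  hnf_s1_inj : forall a a' x, app s a x -> app s a' x -> a = a';
  hnf_s2_inj : forall a b a' b' x x' y, app s a x -> app x b y ->
    app s a' x' -> app x' b' y -> a = a' /\ b = b'
}.

(** * The completion *)

Section Completion.

Context {A : pas} {k s : A} (hnf : unique_hnf k s).

(** * Terms over the pca, their values and their reduction *)

Inductive term : Type := Atom (a : A) | App (M N : term).

(** Relational because application in [A] is partial: a term has a value only if all its subterms
    have one. *)
Inductive value : term -> A -> Prop :=
  | value_atom a : value (Atom a) a
  | value_app M N a b c :
      value M a -> value N b -> app a b c -> value (App M N) c.

(** Evaluation in [A] may turn a head such as [App (Atom k) (Atom a)] into the single atom ka. The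
    redex must survive this, so an atom that is a value ka counts as a head too; likewise sa and sab
    in [s_shape]. *)
Inductive k_shape : term -> term -> Prop :=
  | k_shape_app P : k_shape (App (Atom k) P) P
  | k_shape_atom a x : app k a x -> k_shape (Atom x) (Atom a).

Inductive s_shape : term -> term -> term -> Prop :=
  | s_shape_app P Q : s_shape (App (App (Atom s) P) Q) P Q
  | s_shape_half a x Q : app s a x -> s_shape (App (Atom x) Q) (Atom a) Q
  | s_shape_atom a b x y :
      app s a x -> app x b y -> s_shape (Atom y) (Atom a) (Atom b).

(* Contracting after the head has been reduced makes the relation strongly
   confluent by induction on the head alone. *)
Inductive step : term -> term -> Prop :=
  | step_value M a : value M a -> step M (Atom a)
  | step_app M M' N N' : step M M' -> step N N' -> step (App M N) (App M' N')
  | step_k M M' N P : step M M' -> k_shape M' P -> step (App M N) P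
  | step_s M M' N N' P Q : step M M' -> s_shape M' P Q -> step N N' ->
      step (App M N) (App (App P N') (App Q N')).

Lemma value_atom_inv a b : value (Atom a) b -> b = a.
Proof. now inversion 1. Qed.

Lemma step_refl M : step M M.
Proof.
  induction M; [apply step_value, value_atom | now apply step_app].
Qed.

Lemma value_functional M a b : value M a -> value M b -> a = b.
Proof.
  intros H; revert b; induction H as [a|M N a b c _ IHM _ IHN Happ];
    intros d Hd; inversion Hd; subst; [reflexivity|].
  match goal with
  | HM : value M _, HN : value N _ |- _ => apply IHM in HM; apply IHN in HN
  end; subst.
  eapply app_functional; eassumption.
Qed.

Lemma step_atom a M : step (Atom a) M -> M = Atom a.
Proof.
  intros H; inversion H as [M' b Hb| | |]; subst.
  now inversion Hb.
Qed.

Lemma rank_clash (P : Prop) :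
  (forall rank : A -> nat, rank k = 0 -> rank s = 1 ->
    (forall a x, app k a x -> rank x = 2) ->
    (forall a x, app s a x -> rank x = 3) ->
    (forall a b x y, app s a x -> app x b y -> rank y = 4) -> P) -> P.
Proof.
  destruct (hnf_rank _ _ hnf) as (rank & H0 & H1 & H2 & H3 & H4).
  intros H; exact (H rank H0 H1 H2 H3 H4).
Qed.

(** Computes the rank of one element in two ways. The facts of rank 4 come first, since they need
    the hypotheses [app s a x] that the second loop rewrites away. *)
Ltac clash :=
  exfalso; apply rank_clash; intros rank rank_k rank_s rank_k1 rank_s1 rank_s2;
  repeat match goal with
  | H : app s ?a ?x, H' : app ?x ?b ?y |- _ => apply (rank_s2 a b x y H) in H'
  end;
  repeat match goal with
  | H : app k _ _ |- _ => apply rank_k1 in H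
  | H : app s _ _ |- _ => apply rank_s1 in H
  end;
  congruence.

(** * Values and head shapes under reduction *)

Lemma k1_app a x b c : app k a x -> app x b c -> c = a.
Proof.
  intros Hx Hc; destruct (hnf_is_k _ _ hnf a) as (x' & Hx' & Hk).
  rewrite (app_functional _ _ _ _ _ Hx Hx') in Hc.
  exact (app_functional _ _ _ _ _ Hc (Hk b)).
Qed.

Lemma s2_app a b x y c d : app s a x -> app x b y ->
  app y c d <-> exists ac bc, app a c ac /\ app b c bc /\ app ac bc d.
Proof.
  intros Hx Hy; destruct (hnf_is_s _ _ hnf a b) as (x' & y' & Hx' & Hy' & Hs).
  rewrite (app_functional _ _ _ _ _ Hx Hx') in Hy.
  rewrite (app_functional _ _ _ _ _ Hy Hy'); apply Hs.
Qed.

Lemma k_shape_value M P m : k_shape M P -> value M m ->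
  exists p, value P p /\ app k p m.
Proof.
  intros [P'|a x Hx] Hm; inversion Hm; subst.
  - match goal with H : value (Atom k) _ |- _ => apply value_atom_inv in H end.
    subst; eauto.
  - eauto using value_atom.
Qed.

Lemma s_shape_value M P Q m : s_shape M P Q -> value M m ->
  exists p q x, value P p /\ value Q q /\ app s p x /\ app x q m.
Proof.
  intros [P' Q'|a x Q' Hx|a b x y Hx Hy] Hm; inversion Hm; subst; clear Hm;
    repeat match goal with
    | H : value (Atom _) _ |- _ => apply value_atom_inv in H; subst
    | H : value (App _ _) _ |- _ => inversion H; subst; clear H
    end; eauto 10 using value_atom.
Qed.

(** The k- and s-rules hold in [A]. For the s-rule this uses the Kleene equality from left to right:
    if sabc is defined, so are ac, bc and ac(bc). *)
Lemma value_step M a M' : value M a -> step M M' -> value M' a.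
Proof.
  intros Ha H; revert a Ha; induction H as
    [M b Hb|M M' N N' _ IHM _ IHN|M M' N P _ IHM HP|M M' N N' P Q _ IHM HP _ IHN];
    intros c Hc; [|inversion Hc as [|? ? m n ? Hm Hn Happ]; subst..].
  - rewrite (value_functional _ _ _ Hc Hb); apply value_atom.
  - eauto using value_app.
  - destruct (k_shape_value _ _ _ HP (IHM _ Hm)) as (p & Hp & Hkp).
    now rewrite (k1_app _ _ _ _ Hkp Happ).
  - destruct (s_shape_value _ _ _ _ HP (IHM _ Hm)) as (p & q & x & Hp & Hq & Hx & Hy).
    destruct (proj1 (s2_app _ _ _ _ _ _ Hx Hy) Happ) as (pn & qn & ? & ? & ?).
    eauto 10 using value_app.
Qed.

Lemma k_shape_functional M P P' : k_shape M P -> k_shape M P' -> P = P'.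
Proof.
  intros [Q|a x Hx] H'; inversion H' as [|a' x' Hx']; subst; [reflexivity|].
  f_equal.
  destruct (hnf_is_k _ _ hnf a') as (x' & Hx'' & Hk).
  rewrite <- (app_functional _ _ _ _ _ Hx' Hx'') in Hk.
  (* Any argument recovers a from ka; [k] is the one at hand. *)
  exact (eq_sym (k1_app _ _ _ _ Hx (Hk k))).
Qed.

(** The three shapes differ as terms, so only two readings of the same shape compete, and these
    agree because sa determines a, and sab determines a and b. *)
Lemma s_shape_functional M P Q P' Q' :
  s_shape M P Q -> s_shape M P' Q' -> P = P' /\ Q = Q'.
Proof.
  intros [R T|a x T Hx|a b x y Hx Hy] H';
    inversion H' as [|a' x' T' Hx'|a' b' x' y' Hx' Hy']; subst; auto.
  - now rewrite (hnf_s1_inj _ _ hnf _ _ _ Hx Hx').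
  - now destruct (hnf_s2_inj _ _ hnf _ _ _ _ _ _ _ Hx Hy Hx' Hy') as [-> ->].
Qed.

Lemma k_shape_not_s_shape M P P' Q : k_shape M P -> s_shape M P' Q -> False.
Proof.
  intros [R|a x Hx] H'; inversion H'; subst; clash.
Qed.

(** The head [k] is no redex, by its rank, so a k-shape either reduces inside its argument or
    collapses to an atom ka, which is again a k-shape. *)
Lemma k_shape_step M P M' : k_shape M P -> step M M' ->
  exists P', k_shape M' P' /\ step P P'.
Proof.
  intros [R|a x Hx] H.
  - inversion H as [? m Hm|? K' ? R' HK HR|? K' ? R' HK HR|? K' ? ? ? ? HK HR]; subst.
    + destruct (k_shape_value _ _ _ (k_shape_app R) Hm) as (p & Hp & Hkp).
      eauto using k_shape_atom, step_value.
    + apply step_atom in HK; subst; eauto using k_shape_app.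
    + apply step_atom in HK; subst; inversion HR; clash.
    + apply step_atom in HK; subst; inversion HR; clash.
  - apply step_atom in H; subst; eauto using k_shape_atom, step_refl.
Qed.

Lemma s_shape_step M P Q M' : s_shape M P Q -> step M M' ->
  exists P' Q', s_shape M' P' Q' /\ step P P' /\ step Q Q'.
Proof.
  intros HM H.
  inversion H as [? m Hm|H1 H1' ? ? HH|H1 H1' ? ? HH HR|H1 H1' ? ? ? ? HH HR]; subst.
  - destruct (s_shape_value _ _ _ _ HM Hm) as (p & q & x & Hp & Hq & Hx & Hy).
    eauto 10 using s_shape_atom, step_value.
  - inversion HM as [P' Q'|a x Q' Hx|]; subst.
    + inversion HH as [? y Hy|? H2 ? ? HS|? H2 ? ? HS HR|? H2 ? ? ? ? HS HR]; subst.
      * inversion Hy as [|? ? ? b ? Hs Hb Happ]; subst.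
        inversion Hs; subst; eauto 10 using s_shape_half, step_value.
      * apply step_atom in HS; subst; eauto 10 using s_shape_app.
      * apply step_atom in HS; subst; inversion HR; clash.
      * apply step_atom in HS; subst; inversion HR; clash.
    + apply step_atom in HH; subst; eauto 10 using s_shape_half, step_refl.
  (* The heads [s P] and sa lack an argument: by rank, no reduct of theirs is a k-shape or, in the
     next case, an s-shape. *)
  - exfalso; inversion HM; subst.
    + inversion HH as [? y Hy|? H2 ? ? HS|? H2 ? ? HS HR'|? H2 ? ? ? ? HS HR'];
        subst.
      * inversion Hy as [|? ? ? b ? Hs Hb Happ]; subst.
        inversion Hs; subst; inversion HR; clash.
      * apply step_atom in HS; subst; inversion HR; clash.
      * apply step_atom in HS; subst; inversion HR'; clash.
      * apply step_atom in HS; subst; inversion HR'; clash.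
    + apply step_atom in HH; subst; inversion HR; clash.
  - exfalso; inversion HM; subst.
    + inversion HH as [? y Hy|? H2 ? ? HS|? H2 ? ? HS HR'|? H2 ? ? ? ? HS HR'];
        subst.
      * inversion Hy as [|? ? ? b ? Hs Hb Happ]; subst.
        inversion Hs; subst; inversion HR; clash.
      * apply step_atom in HS; subst; inversion HR; subst; clash.
      * apply step_atom in HS; subst; inversion HR'; clash.
      * apply step_atom in HS; subst; inversion HR'; clash.
    + apply step_atom in HH; subst; inversion HR; clash.
Qed.

(** Two reductions of an application are first joined at their heads by induction. The shapes
    persist down to the common head [M3], where they are of the same kind and have the same parts,
    so both sides reach the same contractum in one step. *)
Lemma step_strongly_confluent : Strongly_confluent term step.
Proof.
  intros M; induction M as [a|M IHM N IHN]; intros X Y HX HY.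
  - apply step_atom in HX, HY; subst; eauto using step_refl.
  (* A term with a value meets each of its reducts in that value. *)
  - assert (Hval : forall c Z, value (App M N) c -> step (App M N) Z ->
              step (Atom c) (Atom c) /\ step Z (Atom c)).
    { intros c Z Hc HZ; split; [apply step_refl|].
      eapply step_value, value_step; eassumption. }
    inversion HX as [? c Hc|? M1 ? N1 HM1 HN1|? M1 ? P1 HM1 HP1
      |? M1 ? N1 P1 Q1 HM1 HP1 HN1]; subst;
    [exists (Atom c); now apply Hval|..];
    (inversion HY as [? c Hc|? M2 ? N2 HM2 HN2|? M2 ? P2 HM2 HP2
      |? M2 ? N2 P2 Q2 HM2 HP2 HN2]; subst;
    [exists (Atom c); now split; apply Hval|..]);
    destruct (IHM _ _ HM1 HM2) as (M3 & H1 & H2);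
    try (destruct (IHN _ _ HN1 HN2) as (N3 & HN1' & HN2')).
    + eauto using step_app.
    + destruct (k_shape_step _ _ _ HP2 H2) as (P3 & HP3 & HP23).
      eauto using step_k.
    + destruct (s_shape_step _ _ _ _ HP2 H2) as (P3 & Q3 & HP3 & HP23 & HQ23).
      exists (App (App P3 N3) (App Q3 N3)); eauto 10 using step_s, step_app.
    + destruct (k_shape_step _ _ _ HP1 H1) as (P3 & HP3 & HP13).
      eauto using step_k.
    + destruct (k_shape_step _ _ _ HP1 H1) as (P3 & HP3 & HP13).
      destruct (k_shape_step _ _ _ HP2 H2) as (P3' & HP3' & HP23).
      rewrite <- (k_shape_functional _ _ _ HP3 HP3') in HP23; eauto.
    + destruct (k_shape_step _ _ _ HP1 H1) as (P3 & HP3 & _).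
      destruct (s_shape_step _ _ _ _ HP2 H2) as (P3' & Q3' & HP3' & _).
      destruct (k_shape_not_s_shape _ _ _ _ HP3 HP3').
    + destruct (s_shape_step _ _ _ _ HP1 H1) as (P3 & Q3 & HP3 & HP13 & HQ13).
      exists (App (App P3 N3) (App Q3 N3)); eauto 10 using step_s, step_app.
    + destruct (s_shape_step _ _ _ _ HP1 H1) as (P3 & Q3 & HP3 & _).
      destruct (k_shape_step _ _ _ HP2 H2) as (P3' & HP3' & _).
      destruct (k_shape_not_s_shape _ _ _ _ HP3' HP3).
    + destruct (s_shape_step _ _ _ _ HP1 H1) as (P3 & Q3 & HP3 & HP13 & HQ13).
      destruct (s_shape_step _ _ _ _ HP2 H2) as (P3' & Q3' & HP3' & HP23 & HQ23).
      destruct (s_shape_functional _ _ _ _ _ HP3 HP3') as [<- <-].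
      exists (App (App P3 N3) (App Q3 N3)); eauto 10 using step_app.
Qed.

(** * Convertibility classes as a total combinatory algebra *)

Definition conv (M N : term) : Prop := coherent term step M N.

Lemma conv_sym M N : conv M N -> conv N M.
Proof. intros (Z & HM & HN); now exists Z. Qed.

Lemma conv_trans M N P : conv M N -> conv N P -> conv M P.
Proof.
  intros (Z & HM & HN) (Z' & HN' & HP).
  destruct (Strong_confluence _ _ step_strongly_confluent N Z Z' HN HN')
    as (W & HZ & HZ').
  exists W; split; eapply Rstar_transitive; eassumption.
Qed.

Lemma step_conv M N : step M N -> conv M N.
Proof.
  intros H; exists N; split; [|apply Rstar_0].
  eapply Rstar_n; [exact H|apply Rstar_0].
Qed.

Lemma conv_refl M : conv M M.
Proof. exact (step_conv _ _ (step_refl M)). Qed.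

Lemma Rstar_app M M' N N' : Rstar term step M M' -> Rstar term step N N' ->
  Rstar term step (App M N) (App M' N').
Proof.
  intros HM HN; apply Rstar_transitive with (App M' N).
  - induction HM; eauto using Rstar_0, Rstar_n, step_app, step_refl.
  - induction HN; eauto using Rstar_0, Rstar_n, step_app, step_refl.
Qed.

Lemma conv_app M M' N N' : conv M M' -> conv N N' -> conv (App M N) (App M' N').
Proof.
  intros (Z & HM & HM') (W & HN & HN').
  exists (App Z W); split; now apply Rstar_app.
Qed.

Lemma Rstar_atom a M : Rstar term step (Atom a) M -> M = Atom a.
Proof.
  intros H; remember (Atom a) as X eqn:HX.
  induction H as [|X Y Z HXY _ IH]; [reflexivity|].
  subst; apply step_atom in HXY; now rewrite (IH HXY).
Qed.

(** Atoms reduce only to themselves; this makes the embedding injective. *)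
Lemma conv_atom a b : conv (Atom a) (Atom b) -> a = b.
Proof.
  intros (Z & Ha & Hb); apply Rstar_atom in Ha, Hb; congruence.
Qed.

(** The quotient by [conv]: a class is a predicate on terms, so that by extensionality and proof
    irrelevance convertible terms have equal classes. *)
Definition cls_type : Type := {P : term -> Prop | exists M, P = conv M}.

Definition cls (M : term) : cls_type := exist _ (conv M) (ex_intro _ M eq_refl).

Lemma cls_surj X : exists M, X = cls M.
Proof. destruct X as (P & M & ->); now exists M. Qed.

Lemma cls_eq M N : conv M N -> cls M = cls N.
Proof.
  intros H; apply subset_eq_compat; apply functional_extensionality; intros P.
  apply propositional_extensionality; split; eauto using conv_sym, conv_trans.
Qed.

Lemma cls_inj M N : cls M = cls N -> conv M N.
Proof.
  intros H; apply (f_equal (@proj1_sig _ _)) in H; cbn in H.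
  rewrite H; apply conv_refl.
Qed.

Definition cls_app (X Y Z : cls_type) : Prop :=
  exists M N, X = cls M /\ Y = cls N /\ Z = cls (App M N).

Lemma cls_app_functional X Y Z Z' : cls_app X Y Z -> cls_app X Y Z' -> Z = Z'.
Proof.
  intros (M & N & -> & -> & ->) (M' & N' & HM & HN & ->).
  apply cls_eq, conv_app; now apply cls_inj.
Qed.

Definition completion : pas := Pas cls_type cls_app cls_app_functional.

Lemma cls_app_intro M N P : conv (App M N) P ->
  @app completion (cls M) (cls N) (cls P).
Proof. intros H; exists M, N; now rewrite (cls_eq _ _ H). Qed.

Lemma cls_app_total M N : @app completion (cls M) (cls N) (cls (App M N)).
Proof. apply cls_app_intro, conv_refl. Qed.

Lemma conv_k M N : conv (App (App (Atom k) M) N) M.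
Proof. eapply step_conv, step_k; [apply step_refl|apply k_shape_app]. Qed.

Lemma conv_s M N P :
  conv (App (App (App (Atom s) M) N) P) (App (App M P) (App N P)).
Proof.
  eapply step_conv, step_s; [apply step_refl|apply s_shape_app|apply step_refl].
Qed.

Lemma completion_is_k : @is_k completion (cls (Atom k)).
Proof.
  intros X; destruct (cls_surj X) as [M ->].
  exists (cls (App (Atom k) M)); split; [apply cls_app_total|].
  intros Y; destruct (cls_surj Y) as [N ->].
  apply cls_app_intro, conv_k.
Qed.

Lemma completion_is_s : @is_s completion (cls (Atom s)).
Proof.
  intros X Y; destruct (cls_surj X) as [M ->], (cls_surj Y) as [N ->].
  exists (cls (App (Atom s) M)), (cls (App (App (Atom s) M) N)).
  split; [apply cls_app_total|]; split; [apply cls_app_total|].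
  intros Z W; destruct (cls_surj Z) as [P ->].
  assert (H := cls_app_intro _ _ _ (conv_s M N P)).
  split.
  - intros HW; exists (cls (App M P)), (cls (App N P)).
    rewrite (app_functional _ _ _ _ _ HW H).
    auto using cls_app_total.
  - intros (X & Y & HX & HY & HW).
    rewrite (app_functional _ _ _ _ _ HX (cls_app_total M P)),
      (app_functional _ _ _ _ _ HY (cls_app_total N P)) in HW.
    now rewrite (app_functional _ _ _ _ _ HW (cls_app_total _ _)).
Qed.

(* A theorem of Bethke, Klop and de Vrijer. *)
Lemma unique_hnf_strongly_completable : strongly_completable A.
Proof.
  assert (Hinj : forall a b, cls (Atom a) = cls (Atom b) -> a = b)
    by (intros a b H; now apply conv_atom, cls_inj).
  exists completion; split.
  - split; [split|].
    + exists (cls (Atom k)), (cls (Atom s)).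
      intros H; apply Hinj in H; clash.
    + eauto using completion_is_k, completion_is_s.
    + intros X Y; destruct (cls_surj X) as [M ->], (cls_surj Y) as [N ->].
      eexists; apply cls_app_total.
  - exists (fun a => cls (Atom a) : completion); split; [split|].
    + exact Hinj.
    + intros a b c H; apply cls_app_intro, step_conv, step_value.
      eauto using value_app, value_atom.
    + exists k, s; destruct hnf; auto using completion_is_k, completion_is_s.
Qed.

End Completion.

(** * Programs without unbounded search *)

Arguments pair_nat : simpl never.
Arguments left_nat : simpl never.
Arguments right_nat : simpl never.

Lemma pair_eta x : pair_nat (left_nat x) (right_nat x) = x.
Proof.
  unfold pair_nat, left_nat, right_nat.
  now rewrite <- surjective_pairing, Cantor.cancel_to_of.
Qed.

Fixpoint mu_free (c : code) : bool :=
  match c with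
  | Mu _ => false
  | Pair c d | Comp c d | Prec c d => mu_free c && mu_free d
  | _ => true
  end.

(** Programs without [Mu] are total, so their evaluation becomes a function that can be rewritten
    with; 0 at [Mu] is a default value. *)
Fixpoint den (f : nat -> nat) (c : code) (x : nat) : nat :=
  match c with
  | Zero | Mu _ => 0
  | Succ => S x
  | Left => left_nat x
  | Right => right_nat x
  | Query => f x
  | Pair c d => pair_nat (den f c x) (den f d x)
  | Comp c d => den f c (den f d x)
  | Prec c d =>
      nat_rec (fun _ => nat) (den f c (left_nat x))
        (fun i z => den f d (pair_nat (left_nat x) (pair_nat i z)))
        (right_nat x)
  end.

Lemma eval_den_self f c x : mu_free c = true -> eval f c x (den f c x).
Proof.
  revert x; induction c; cbn; intros x H; try reflexivity; try discriminate;
    apply andb_prop in H as [H1 H2]; eauto 10.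
  induction (right_nat x) as [|n IH]; cbn; eauto.
Qed.

Lemma eval_den f c x y : mu_free c = true -> eval f c x y <-> y = den f c x.
Proof.
  intros H; split.
  - intros Hy; exact (eval_functional _ _ _ _ _ Hy (eval_den_self f c x H)).
  - intros ->; now apply eval_den_self.
Qed.

Definition idc : code := Pair Left Right.

Definition const (n : nat) : code := Nat.iter n (Comp Succ) Zero.

(** Stage i + 1 of the recursion returns its counter i. *)
Definition predc : code := Comp (Prec Zero (Comp Left Right)) (Pair Zero idc).

(* Both [b] and [d] are run, so neither may diverge. *)
Definition ifz (c b d : code) : code :=
  Comp (Prec b (Comp d Left)) (Pair idc c).

Fixpoint switch (c : code) (bs : list code) (d : code) : code :=
  match bs with
  | [] => d
  | b :: bs => ifz c b (switch (Comp predc c) bs d)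
  end.

Lemma den_idc f x : den f idc x = x.
Proof. apply pair_eta. Qed.

Lemma den_const f n x : den f (const n) x = n.
Proof. induction n as [|n IH]; [reflexivity|exact (f_equal S IH)]. Qed.

Lemma den_predc f x : den f predc x = pred x.
Proof.
  cbn; rewrite right_pair, pair_eta; destruct x; cbn; [reflexivity|].
  now rewrite right_pair, left_pair.
Qed.

Lemma den_ifz f c b d x :
  den f (ifz c b d) x = match den f c x with 0 => den f b x | S _ => den f d x end.
Proof.
  cbn; rewrite right_pair, left_pair, pair_eta.
  destruct (den f c x); cbn; [reflexivity|]; now rewrite left_pair.
Qed.

Lemma den_switch f c bs d x :
  den f (switch c bs d) x = den f (nth (den f c x) bs d) x.
Proof.
  revert c; induction bs as [|b bs IH]; intros c; [now destruct (den f c x)|].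
  cbn [switch]; rewrite den_ifz, IH; cbn [den]; rewrite den_predc.
  now destruct (den f c x).
Qed.

Lemma mu_free_const n : mu_free (const n) = true.
Proof. now induction n. Qed.

(** * A universal code *)

(* A state <0, <v, K>> returns the value v to the stack K;
   a state <1, <<e, x>, K>> evaluates the index e at x.  A frame is a pair
   <tag, data>; the tag 0 marks the bottom of the stack. *)

Definition frame (t d K : nat) : nat := pair_nat (pair_nat t d) K.
Definition bottom : nat := frame 0 0 0.
Definition ret (v K : nat) : nat := pair_nat 0 (pair_nat v K).
Definition call (e x K : nat) : nat := pair_nat 1 (pair_nat (pair_nat e x) K).

Definition framec (t : nat) (d K : code) : code := Pair (Pair (const t) d) K.
Definition retc (v K : code) : code := Pair Zero (Pair v K).
Definition callc (e x K : code) : code := Pair (const 1) (Pair (Pair e x) K).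

Definition valc : code := Comp Left Right.
Definition stackc : code := Comp Right Right.

(** The branches follow the tags of [decode_fuel]; the default branch is [Mu], as it is there. *)
Definition call_stepc : code :=
  let E := Comp Left valc in
  let X := Comp Right valc in
  let K := stackc in
  let R := Comp Right E in
  let C := Comp Left R in
  let D := Comp Right R in
  switch (Comp Left E)
    [ retc Zero K;
      retc (Comp Succ X) K;
      retc (Comp Left X) K;
      retc (Comp Right X) K;
      retc (Comp Query X) K;
      callc C X (framec 1 (Pair D X) K);
      callc D X (framec 2 C K);
      callc C (Comp Left X)
        (framec 3 (Pair (Pair D (Comp Left X)) (Pair Zero (Comp Right X))) K) ]
    (callc R (Pair X Zero) (framec 4 (Pair R (Pair X Zero)) K)).

(* Frames: 1 <d, x> runs d at x and pairs the results, which leaves a frame 5;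
   2 c composes; 3 <<d, a>, <i, n>> has n more steps of a recursion to run;
   4 <c, <x, m>> searches from m on. *)
Definition ret_stepc : code :=
  let V := valc in
  let F := Comp Left stackc in
  let Dt := Comp Right F in
  let K := Comp Right stackc in
  let DL := Comp Left Dt in
  let DR := Comp Right Dt in
  let I := Comp Left DR in
  let N := Comp Right DR in
  switch (Comp Left F)
    [ idc;
      callc DL DR (framec 5 V K);
      callc Dt V K;
      ifz N (retc V K)
        (callc (Comp Left DL) (Pair (Comp Right DL) (Pair I V))
          (framec 3 (Pair DL (Pair (Comp Succ I) (Comp predc N))) K));
      ifz V (retc N K)
        (callc DL (Pair I (Comp Succ N))
          (framec 4 (Pair DL (Pair I (Comp Succ N))) K)) ]
    (retc (Pair Dt V) K).

Definition stepc : code := ifz Left ret_stepc call_stepc.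

(** On a return state this is the tag of the top frame, hence 0 exactly when a value is returned to
    the bottom of the stack. *)
Definition haltedc : code :=
  ifz Left (Comp Left (Comp Left stackc)) (const 1).

(** Here [stackc] serves as the projection that extracts the previous state z from the argument <a,
    <i, z>> of the recursion step. *)
Definition runc : code :=
  Prec (callc Left Right (framec 0 Zero Zero)) (Comp stepc stackc).

(** The only unbounded search is for the number of machine steps; the machine is then run again for
    that long and its value is read off. *)
Definition univ : code :=
  Comp (Comp valc runc) (Pair idc (Mu (Comp haltedc runc))).

(** * Runs of the stack machine *)

Definition run (f : nat -> nat) (n st : nat) : nat := Nat.iter n (den f stepc) st.

Lemma den_runc f e x n :
  den f runc (pair_nat (pair_nat e x) n) = run f n (call e x bottom).
Proof.
  unfold runc; cbn [den]; rewrite !left_pair, !right_pair.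
  induction n as [|n IH].
  - unfold callc, framec; cbn [den nat_rec nat_rect]; now rewrite left_pair, right_pair.
  - change (run f (S n) (call e x bottom))
      with (den f stepc (run f n (call e x bottom))).
    rewrite <- IH; cbn [nat_rec nat_rect]; unfold stackc at 1; cbn [den].
    now rewrite !right_pair.
Qed.

Ltac pairs := rewrite ?left_pair, ?right_pair in *.

Lemma step_call f e x K :
  den f stepc (call e x K) =
  let r := right_nat e in
  let c := left_nat r in
  let d := right_nat r in
  match left_nat e with
  | 0 => ret 0 K
  | 1 => ret (S x) K
  | 2 => ret (left_nat x) K
  | 3 => ret (right_nat x) K
  | 4 => ret (f x) K
  | 5 => call c x (frame 1 (pair_nat d x) K)
  | 6 => call d x (frame 2 c K)
  | 7 => call c (left_nat x)
           (frame 3 (pair_nat (pair_nat d (left_nat x))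
                              (pair_nat 0 (right_nat x))) K)
  | _ => call r (pair_nat x 0) (frame 4 (pair_nat r (pair_nat x 0)) K)
  end.
Proof.
  unfold stepc; rewrite den_ifz; unfold call at 1; cbn [den]; rewrite left_pair.
  unfold call_stepc; cbv zeta; rewrite den_switch.
  unfold callc, retc, framec, valc, stackc, call.
  cbn [den]; pairs; rewrite !left_pair.
  destruct (left_nat e) as [|[|[|[|[|[|[|[|n]]]]]]]]; cbn [nth den];
    rewrite ?den_const, ?right_pair, ?left_pair, ?right_pair, ?left_pair; try reflexivity.
  now destruct n; cbn [nth den];
    rewrite ?den_const, ?right_pair, ?left_pair, ?right_pair, ?left_pair.
Qed.

Lemma step_ret f v K :
  den f stepc (ret v K) =
  let t := left_nat (left_nat K) in
  let dt := right_nat (left_nat K) in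
  let K' := right_nat K in
  let dl := left_nat dt in
  let dr := right_nat dt in
  let i := left_nat dr in
  let n := right_nat dr in
  match t with
  | 0 => ret v K
  | 1 => call dl dr (frame 5 v K')
  | 2 => call dt v K'
  | 3 => match n with
         | 0 => ret v K'
         | S n => call (left_nat dl) (pair_nat (right_nat dl) (pair_nat i v))
                    (frame 3 (pair_nat dl (pair_nat (S i) n)) K')
         end
  | 4 => match v with
         | 0 => ret n K'
         | S _ => call dl (pair_nat i (S n))
                    (frame 4 (pair_nat dl (pair_nat i (S n))) K')
         end
  | _ => ret (pair_nat dt v) K'
  end.
Proof.
  unfold stepc; rewrite den_ifz; unfold ret at 1; cbn [den]; rewrite left_pair.
  unfold ret_stepc; cbv zeta; rewrite den_switch.
  unfold callc, retc, framec, valc, stackc, ret.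
  cbn [den]; rewrite !right_pair.
  destruct (left_nat (left_nat K)) as [|[|[|[|[|n]]]]]; cbn [nth];
    rewrite ?den_idc, ?den_ifz; cbn [den];
    rewrite ?den_const, ?right_pair, ?left_pair, ?right_pair, ?left_pair,
      ?den_predc; try reflexivity.
  - now destruct (right_nat (right_nat (right_nat (left_nat K)))).
  - now destruct n; cbn [nth den];
      rewrite ?den_const, ?right_pair, ?left_pair, ?right_pair, ?left_pair.
Qed.

Lemma step_ret_frame f v t d K :
  den f stepc (ret v (frame t d K)) =
  match t with
  | 0 => ret v (frame t d K)
  | 1 => call (left_nat d) (right_nat d) (frame 5 v K)
  | 2 => call d v K
  | 3 => match right_nat (right_nat d) with
         | 0 => ret v K
         | S n =>
             call (left_nat (left_nat d))
               (pair_nat (right_nat (left_nat d))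
                 (pair_nat (left_nat (right_nat d)) v))
               (frame 3 (pair_nat (left_nat d)
                          (pair_nat (S (left_nat (right_nat d))) n)) K)
         end
  | 4 => match v with
         | 0 => ret (right_nat (right_nat d)) K
         | S _ =>
             let z := pair_nat (left_nat (right_nat d))
                        (S (right_nat (right_nat d))) in
             call (left_nat d) z (frame 4 (pair_nat (left_nat d) z) K)
         end
  | _ => ret (pair_nat d v) K
  end.
Proof.
  assert (Ht : left_nat (left_nat (frame t d K)) = t)
    by (unfold frame; now rewrite !left_pair).
  assert (Hd : right_nat (left_nat (frame t d K)) = d)
    by (unfold frame; now rewrite left_pair, right_pair).
  assert (HK : right_nat (frame t d K) = K) by apply right_pair.
  rewrite step_ret; cbv zeta; now rewrite Ht, Hd, HK.
Qed.

Lemma halted_call f e x K : den f haltedc (call e x K) = 1.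
Proof.
  unfold haltedc; rewrite den_ifz; unfold call; cbn [den]; rewrite left_pair.
  apply den_const.
Qed.

Lemma halted_ret f v t d K : den f haltedc (ret v (frame t d K)) = t.
Proof.
  unfold haltedc; rewrite den_ifz; unfold ret, frame, stackc; cbn [den].
  now rewrite !left_pair, !right_pair, !left_pair.
Qed.

(** * Soundness of the universal code *)

Definition halts (f : nat -> nat) (n st w : nat) : Prop :=
  den f haltedc (run f n st) = 0 /\ den f valc (run f n st) = w.

Lemma halts_inv f n st w : halts f n st w -> den f haltedc st <> 0 ->
  exists m, n = S m /\ halts f m (den f stepc st) w.
Proof.
  intros H Hst; destruct n as [|n]; [now destruct Hst; apply H|].
  exists n; split; [reflexivity|].
  unfold halts, run in *; rewrite Nat.iter_succ_r in H; exact H.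
Qed.

Lemma halts_call f n e x K w : halts f n (call e x K) w ->
  exists m, n = S m /\ halts f m (den f stepc (call e x K)) w.
Proof. intros H; apply halts_inv; [exact H|now rewrite halted_call]. Qed.

Lemma halts_ret f n v t d K w : t <> 0 -> halts f n (ret v (frame t d K)) w ->
  exists m, n = S m /\ halts f m (den f stepc (ret v (frame t d K))) w.
Proof. intros Ht H; apply halts_inv; [exact H|now rewrite halted_ret]. Qed.

(** A halted state is a fixed point, so the value read off does not depend on how many further steps
    are made. *)
Lemma run_bottom f n v : run f n (ret v bottom) = ret v bottom.
Proof.
  induction n as [|n IH]; [reflexivity|].
  change (run f (S n) (ret v bottom)) with (den f stepc (run f n (ret v bottom))).
  rewrite IH; apply step_ret_frame.
Qed.

Lemma val_ret f v K : den f valc (ret v K) = v.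
Proof. unfold valc, ret; cbn [den]; now rewrite right_pair, left_pair. Qed.

Lemma index_parts e : left_nat e + right_nat e <= e.
Proof.
  rewrite <- (pair_eta e) at 3; rewrite Nat.add_comm; apply pair_ge.
Qed.

(** A halting run that starts with a call must pass through the return of that call. An arbitrary
    stack [K] allows nested calls, and the strict decrease m < n allows induction on the remaining
    machine steps. *)
Definition sound (f : nat -> nat) (e : nat) (c : code) : Prop :=
  forall x K n w, halts f n (call e x K) w ->
  exists y m, m < n /\ eval f c x y /\ halts f m (ret y K) w.

(** Induction on the number N of stages left. The invariant is that z is the i-th value of the
    recursion, while i + N stays constant. *)
Lemma sound_prec_loop f d D g a K w : sound f d D ->
  forall N i z n,
  halts f n (ret z (frame 3 (pair_nat (pair_nat d a) (pair_nat i N)) K)) w ->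
  let P := prec_graph g (fun i z => eval f D (pair_nat a (pair_nat i z))) in
  P i z -> exists y m, m < n /\ P (i + N) y /\ halts f m (ret y K) w.
Proof.
  intros HD N; induction N as [|N IH]; intros i z n H P Hz;
    (apply halts_ret in H as (n' & -> & H); [|discriminate]);
    rewrite step_ret_frame, !left_pair, !right_pair, ?left_pair, ?right_pair in H.
  - exists z, n'; rewrite Nat.add_0_r; auto.
  - apply HD in H as (z' & m & Hm & Hz' & H).
    apply IH in H as (y & m' & Hm' & Hy & H); [|exists z; auto].
    exists y, m'; rewrite Nat.add_succ_r; split; [lia|]; split; [exact Hy|exact H].
Qed.

(** The number of rounds of the search is not known in advance, so the induction is on the remaining
    machine steps. *)
Lemma sound_mu_loop f c C x K w : sound f c C ->
  forall n i,
  halts f n (call c (pair_nat x i)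
               (frame 4 (pair_nat c (pair_nat x i)) K)) w ->
  (forall j, j < i -> exists v, eval f C (pair_nat x j) (S v)) ->
  exists y m, m < n /\ eval f (Mu C) x y /\ halts f m (ret y K) w.
Proof.
  intros HC n; induction n as [n IH] using lt_wf_ind; intros i H Hi.
  apply HC in H as (v & m & Hm & Hv & H).
  apply halts_ret in H as (m' & -> & H); [|discriminate].
  rewrite step_ret_frame, !left_pair, !right_pair, ?left_pair, ?right_pair in H.
  destruct v as [|v].
  - exists i, m'; split; [lia|]; split; [split; [exact Hv|exact Hi]|exact H].
  - apply IH in H as (y & m & Hm' & Hy & H); [|lia|].
    + exists y, m; split; [lia|]; split; [exact Hy|exact H].
    + intros j Hj; destruct (Nat.eq_dec j i) as [->|]; [eauto|apply Hi; lia].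
Qed.

(** Induction on the decoding fuel: for the tags from 5 on, the data of e and its components are
    smaller than e. *)
Lemma univ_sound f k e : e < k -> sound f e (decode_fuel k e).
Proof.
  revert e; induction k as [|k IH]; intros e He; [lia|]; intros x K n w H.
  apply halts_call in H as (n' & -> & H); rewrite step_call in H.
  cbv zeta in H; cbn [decode_fuel].
  pose proof (index_parts e); pose proof (index_parts (right_nat e)).
  destruct (left_nat e) as [|[|[|[|[|[|[|[|t]]]]]]]].
  (* The basic instructions return after one step. *)
  1-5: eexists _, n'; split; [lia|]; split; [reflexivity|exact H].
  - apply IH in H as (u & m & Hm & Hu & H); [|lia].
    apply halts_ret in H as (m' & -> & H); [|discriminate].
    rewrite step_ret_frame, left_pair, right_pair in H.
    apply IH in H as (v & m'' & Hm' & Hv & H); [|lia].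
    apply halts_ret in H as (m''' & -> & H); [|discriminate].
    rewrite step_ret_frame in H.
    exists (pair_nat u v), m'''; split; [lia|]; split; [cbn; eauto|exact H].
  - apply IH in H as (u & m & Hm & Hu & H); [|lia].
    apply halts_ret in H as (m' & -> & H); [|discriminate].
    rewrite step_ret_frame in H.
    apply IH in H as (v & m'' & Hm' & Hv & H); [|lia].
    exists v, m''; split; [lia|]; split; [cbn; eauto|exact H].
  - apply IH in H as (u & m & Hm & Hu & H); [|lia].
    apply sound_prec_loop with (D := decode_fuel k (right_nat (right_nat e)))
      (g := eval f (decode_fuel k (left_nat (right_nat e))) (left_nat x)) in H
      as (y & m' & Hm' & Hy & H); [|apply IH; lia|exact Hu].
    exists y, m'; split; [lia|]; split; [exact Hy|exact H].
  - apply sound_mu_loop with (C := decode_fuel k (right_nat e)) in H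
      as (y & m & Hm & Hy & H); [|apply IH; lia|lia].
    exists y, m; split; [lia|]; split; [exact Hy|exact H].
Qed.

(** * Completeness of the universal code *)

Definition reach (f : nat -> nat) (st st' : nat) : Prop :=
  exists n, run f n st = st'.

Lemma reach_step f st st' : reach f (den f stepc st) st' -> reach f st st'.
Proof.
  intros [n Hn]; exists (S n); unfold run; now rewrite Nat.iter_succ_r.
Qed.

Lemma reach_refl f st : reach f st st.
Proof. now exists 0. Qed.

Lemma reach_trans f st st' st'' : reach f st st' -> reach f st' st'' ->
  reach f st st''.
Proof.
  intros [n Hn] [m Hm]; exists (m + n); unfold run in *.
  now rewrite Nat.iter_add, Hn.
Qed.

(** The length of the recursion is split into n stages done and N stages left, so that the induction
    on n can pass from N to N + 1. *)
Lemma reach_prec f c d x K C D :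
  (forall x y K, eval f C x y -> reach f (call c x K) (ret y K)) ->
  (forall x y K, eval f D x y -> reach f (call d x K) (ret y K)) ->
  forall n y N,
  prec_graph (eval f C x) (fun i z => eval f D (pair_nat x (pair_nat i z))) n y ->
  reach f
    (call c x (frame 3 (pair_nat (pair_nat d x) (pair_nat 0 (n + N))) K))
    (ret y (frame 3 (pair_nat (pair_nat d x) (pair_nat n N)) K)).
Proof.
  intros HC HD n; induction n as [|n IH]; intros y N; [apply HC|].
  intros (z & Hz & Hy).
  eapply reach_trans; [rewrite Nat.add_succ_comm; exact (IH z (S N) Hz)|].
  apply reach_step; rewrite step_ret_frame.
  rewrite !left_pair, !right_pair, ?left_pair, ?right_pair.
  now apply HD.
Qed.

Lemma reach_mu f c x K C i :
  (forall x y K, eval f C x y -> reach f (call c x K) (ret y K)) ->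
  (forall j, j < i -> exists v, eval f C (pair_nat x j) (S v)) ->
  let st i := call c (pair_nat x i) (frame 4 (pair_nat c (pair_nat x i)) K) in
  reach f (st 0) (st i).
Proof.
  intros HC; induction i as [|i IH]; intros Hi st; [apply reach_refl|].
  eapply reach_trans; [apply IH; auto|].
  destruct (Hi i) as [v Hv]; [lia|].
  eapply reach_trans; [apply HC, Hv|].
  apply reach_step; rewrite step_ret_frame.
  rewrite !left_pair, !right_pair, ?left_pair, ?right_pair.
  apply reach_refl.
Qed.

Lemma univ_complete f k e x y K : e < k -> eval f (decode_fuel k e) x y ->
  reach f (call e x K) (ret y K).
Proof.
  revert e x y K; induction k as [|k IH]; intros e x y K He Hy; [lia|].
  apply reach_step; rewrite step_call; cbv zeta; cbn [decode_fuel] in Hy.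
  pose proof (index_parts e); pose proof (index_parts (right_nat e)).
  destruct (left_nat e) as [|[|[|[|[|[|[|[|t]]]]]]]].
  1-5: cbn in Hy; subst y; apply reach_refl.
  - destruct Hy as (u & v & Hu & Hv & ->).
    eapply reach_trans; [apply IH; [lia|exact Hu]|].
    apply reach_step; rewrite step_ret_frame, left_pair, right_pair.
    eapply reach_trans; [apply IH; [lia|exact Hv]|].
    apply reach_step; rewrite step_ret_frame; apply reach_refl.
  - destruct Hy as (u & Hu & Hv).
    eapply reach_trans; [apply IH; [lia|exact Hu]|].
    apply reach_step; rewrite step_ret_frame.
    apply IH; [lia|exact Hv].
  - cbn [eval] in Hy.
    eapply reach_trans.
    { rewrite <- (Nat.add_0_r (right_nat x)).
      eapply reach_prec with (C := decode_fuel k (left_nat (right_nat e)))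
        (D := decode_fuel k (right_nat (right_nat e)));
        [intros; apply IH; [lia|assumption]..|exact Hy]. }
    apply reach_step; rewrite step_ret_frame, !right_pair; apply reach_refl.
  - destruct Hy as [Hy0 Hlt].
    eapply reach_trans.
    { apply reach_mu with (C := decode_fuel k (right_nat e)) (i := y);
        [intros; apply IH; [lia|assumption]|exact Hlt]. }
    eapply reach_trans; [apply IH; [lia|exact Hy0]|].
    apply reach_step; rewrite step_ret_frame, !right_pair; apply reach_refl.
Qed.

Lemma eval_mu_den f c x y : mu_free c = true ->
  eval f (Mu c) x y <-> den f c (pair_nat x y) = 0 /\
    forall m, m < y -> den f c (pair_nat x m) <> 0.
Proof.
  intros Hc; cbn; rewrite (eval_den f c) by exact Hc; split; intros [H0 Hm];
    (split; [congruence|]); intros m Hlt; specialize (Hm m Hlt).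
  - destruct Hm as [v Hv]; rewrite eval_den in Hv by exact Hc; congruence.
  - destruct (den f c (pair_nat x m)) as [|v] eqn:E; [easy|].
    exists v; now rewrite eval_den.
Qed.

(** [Mu] stops at the first zero, whereas completeness of the machine provides just some halting
    time. *)
Lemma least_zero (F : nat -> nat) n :
  F n = 0 -> exists m, F m = 0 /\ forall i, i < m -> F i <> 0.
Proof.
  induction n as [n IH] using lt_wf_ind; intros Hn.
  assert (H : (exists i, i < n /\ F i = 0) \/ forall i, i < n -> F i <> 0).
  { clear; induction n as [|n [(i & Hi & H)|H]]; [right; lia|left..|].
    - exists i; split; [lia|exact H].
    - destruct (Nat.eq_dec (F n) 0) as [E|E]; [left; exists n; auto|right].
      intros i Hi; destruct (Nat.eq_dec i n) as [->|]; [exact E|apply H; lia]. }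
  destruct H as [(i & Hi & H)|H]; eauto.
Qed.

Lemma eval_univ f e x y : eval f univ (pair_nat e x) y <-> Phi e f x y.
Proof.
  assert (E : eval f univ (pair_nat e x) y <->
    exists n, (forall m, m < n ->
        den f haltedc (run f m (call e x bottom)) <> 0) /\
      halts f n (call e x bottom) y).
  { assert (Hrun : forall n, den f (Comp haltedc runc) (pair_nat (pair_nat e x) n)
        = den f haltedc (run f n (call e x bottom)))
      by (intros n; cbn [den]; now rewrite den_runc).
    assert (Hval : forall n, eval f (Comp valc runc) (pair_nat (pair_nat e x) n) y
        <-> den f valc (run f n (call e x bottom)) = y).
    { intros n; rewrite eval_den by reflexivity; cbn [den]; rewrite den_runc.
      split; congruence. }
    unfold univ; split.
    - intros (u & (a & n & Ha & Hn & ->) & Hy).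
      apply eval_den in Ha; [|reflexivity]; rewrite den_idc in Ha; subst a.
      apply eval_mu_den in Hn as [H0 Hlt]; [|reflexivity].
      exists n; split; [intros m Hm; rewrite <- Hrun; now apply Hlt|].
      split; [now rewrite <- Hrun|now apply Hval].
    - intros (n & Hlt & H0 & Hy).
      exists (pair_nat (pair_nat e x) n); split; [|now apply Hval].
      exists (pair_nat e x), n; split; [|split; [|reflexivity]].
      + apply eval_den; [reflexivity|]; now rewrite den_idc.
      + apply eval_mu_den; [reflexivity|]; split; [now rewrite Hrun|].
        intros m Hm; rewrite Hrun; now apply Hlt. }
  rewrite E; clear E; unfold Phi, decode.
  assert (Hsound : forall n w, halts f n (call e x bottom) w ->
    eval f (decode_fuel (S e) e) x w).
  (* The call returns its value to the bottom frame, where the machine stays, so that value is w. *)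
  { intros n w H; apply (univ_sound f (S e)) in H as (v & m & _ & Hv & H); [|lia].
    destruct H as [_ H]; rewrite run_bottom, val_ret in H; now subst. }
  split.
  - intros (n & _ & H); eauto.
  - intros Hy.
    destruct (univ_complete f (S e) e x y bottom (Nat.lt_succ_diag_r e) Hy) as [n Hn].
    destruct (least_zero (fun n => den f haltedc (run f n (call e x bottom))) n)
      as (m & Hm & Hlt); [rewrite Hn; apply halted_ret|].
    exists m; split; [exact Hlt|]; split; [exact Hm|].
    (* By soundness the value at the first halting time m is also a value of the program, hence
       equal to y. *)
    eapply eval_functional; [|exact Hy].
    now apply (Hsound m).
Qed.

(** * Combinators for the second model *)

(* Opaque, lest conversion compute the unary number [encode c]. *)
Lemma index_sig (c : code) : {e | decode e = c}.
Proof. exists (encode c); apply decode_encode. Qed.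

Definition index (c : code) : nat := proj1_sig (index_sig c).

Lemma decode_index c : decode (index c) = c.
Proof. exact (proj2_sig (index_sig c)). Qed.

(** * Programs relative to computed oracles *)

Fixpoint relativize (q c : code) : code :=
  match c with
  | Query => q
  | Pair c d => Pair (relativize q c) (relativize q d)
  | Comp c d => Comp (relativize q c) (relativize q d)
  | Prec c d => Prec (relativize q c) (relativize q d)
  | Mu c => Mu (relativize q c)
  | c => c
  end.

Definition computes (f : nat -> nat) (c : code) (g : nat -> nat) : Prop :=
  forall n, eval f c n (g n).

Lemma computes_eq f c g x y : computes f c g -> eval f c x y <-> y = g x.
Proof.
  intros H; split; [|intros ->; apply H].
  intros Hy; exact (eval_functional _ _ _ _ _ Hy (H x)).
Qed.

Lemma prec_graph_ext (g g' : nat -> Prop) (h h' : nat -> nat -> nat -> Prop) :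
  (forall y, g y <-> g' y) -> (forall i z y, h i z y <-> h' i z y) ->
  forall n y, prec_graph g h n y <-> prec_graph g' h' n y.
Proof.
  intros Hg Hh n; induction n as [|n IH]; intros y; cbn; [apply Hg|].
  now setoid_rewrite IH; setoid_rewrite Hh.
Qed.

Lemma eval_relativize f q g c x y : computes f q g ->
  eval f (relativize q c) x y <-> eval g c x y.
Proof.
  intros H; revert x y; induction c as
    [| | | | |c IHc d IHd|c IHc d IHd|c IHc d IHd|c IHc]; intros x y; cbn;
    try reflexivity.
  - now apply computes_eq.
  - setoid_rewrite IHc; now setoid_rewrite IHd.
  - setoid_rewrite IHc; now setoid_rewrite IHd.
  - apply prec_graph_ext; [apply IHc|intros; apply IHd].
  - rewrite IHc; now setoid_rewrite IHc.
Qed.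

Definition doublec : code :=
  Comp (Prec Zero (Comp Succ (Comp Succ (Comp Right Right)))) (Pair Zero idc).

(** The recursion carries the pair of quotient and parity. *)
Definition halfc : code :=
  let z := Comp Right Right in
  Comp (Prec (Pair Zero Zero)
      (ifz (Comp Right z) (Pair (Comp Left z) (const 1))
        (Pair (Comp Succ (Comp Left z)) Zero)))
    (Pair Zero idc).

Lemma den_doublec f n : den f doublec n = 2 * n.
Proof.
  unfold doublec; cbn [den]; rewrite den_idc, left_pair, right_pair; unfold nat_rec.
  induction n as [|n IH]; cbn [nat_rect]; [reflexivity|].
  rewrite !right_pair, IH; lia.
Qed.

Lemma den_halfc f n :
  den f halfc n = pair_nat (Nat.div2 n) (if Nat.even n then 0 else 1).
Proof.
  unfold halfc; cbn [den]; rewrite den_idc, left_pair, right_pair; unfold nat_rec.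
  induction n as [|n IH]; cbn [nat_rect]; [reflexivity|].
  rewrite IH, den_ifz; cbn [den]; rewrite !right_pair, !left_pair, den_const.
  rewrite Nat.even_succ, <- Nat.negb_even.
  destruct (Nat.even n) eqn:E; cbn [negb].
  - apply Nat.even_spec in E as [m ->].
    now rewrite Nat.div2_succ_double, Nat.div2_double.
  - assert (O : Nat.odd n = true) by now rewrite <- Nat.negb_even, E.
    apply Nat.odd_spec in O as [m ->].
    replace (S (2 * m + 1)) with (2 * S m) by lia.
    rewrite Nat.add_1_r, Nat.div2_succ_double.
    now rewrite Nat.div2_double.
Qed.

Definition queryl : code := Comp Query doublec.
Definition queryr : code := Comp Query (Comp Succ doublec).

Lemma den_queryl a b n : den (join a b) queryl n = a n.
Proof.
  unfold queryl; cbn [den]; rewrite den_doublec; unfold join.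
  now rewrite Nat.even_even, Nat.div2_double.
Qed.

Lemma den_queryr a b n : den (join a b) queryr n = b n.
Proof.
  unfold queryr; cbn [den]; rewrite den_doublec; unfold join.
  now rewrite Nat.div2_succ_double, <- Nat.add_1_r, Nat.even_odd.
Qed.

(** Both programs run at half the argument before the parity selects a value, so that the selecting
    part is free of [Mu] and [den] applies to it. *)
Definition joinc (p q : code) : code :=
  Comp (ifz Left (Comp Left Right) (Comp Right Right))
    (Comp (Pair Right (Pair (Comp p Left) (Comp q Left))) halfc).

Lemma computes_joinc f p q a b : computes f p a -> computes f q b ->
  computes f (joinc p q) (join a b).
Proof.
  intros Hp Hq n; unfold joinc.
  set (h := den f halfc n).
  exists (pair_nat (right_nat h)
    (pair_nat (a (left_nat h)) (b (left_nat h)))); split.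
  - exists h; split; [now apply eval_den_self|]; clearbody h; cbn [eval].
    exists (right_nat h), (pair_nat (a (left_nat h)) (b (left_nat h))).
    split; [reflexivity|]; split; [|reflexivity].
    exists (a (left_nat h)), (b (left_nat h)).
    split; [exists (left_nat h); auto|]; split; [exists (left_nat h); auto|].
    reflexivity.
  - apply eval_den; [reflexivity|]; rewrite den_ifz; cbn [den].
    unfold h; rewrite den_halfc; unfold join.
    destruct (Nat.even n); now rewrite ?left_pair, ?right_pair, ?left_pair.
Qed.

(** The index a(0) is known only at run time, so the universal code runs it, its oracle replaced by
    a program for the join of a and b. *)
Definition applyc (p q : code) : code :=
  Comp (relativize (joinc p q) univ) (Pair (Comp p Zero) idc).

Lemma eval_applyc f p q a b n y : computes f p a -> computes f q b ->
  eval f (applyc p q) n y <-> Phi (a 0) (join a b) n y.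
Proof.
  intros Hp Hq; unfold applyc; cbn [eval].
  assert (Hz : forall u, eval f (Pair (Comp p Zero) idc) n u <->
    u = pair_nat (a 0) n).
  { intros u; split.
    - intros (v & w & (z & -> & Hv) & Hw & ->).
      apply eval_den in Hw; [|reflexivity]; rewrite den_idc in Hw.
      apply (computes_eq _ _ _ _ _ Hp) in Hv; congruence.
    - intros ->; exists (a 0), n; split; [|split; [|reflexivity]].
      + exists 0; split; [reflexivity|apply Hp].
      + apply eval_den; [reflexivity|]; now rewrite den_idc. }
  assert (Hr := eval_relativize f (joinc p q) (join a b) univ (pair_nat (a 0) n) y
    (computes_joinc _ _ _ _ _ Hp Hq)).
  rewrite eval_univ in Hr; rewrite <- Hr; split.
  - intros (u & Hu & Hy); apply Hz in Hu; now subst.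
  - intros Hy; exists (pair_nat (a 0) n); split; [now apply Hz|exact Hy].
Qed.

Lemma computes_applyc f p q a b c : computes f p a -> computes f q b ->
  computes f (applyc p q) c <-> K2_app a b c.
Proof.
  intros Hp Hq; split; intros H n; apply (eval_applyc f p q a b); auto.
Qed.

(** [applyc] combines programs for a and b, here relative to the zero oracle. *)
Lemma K2_app_computable a b c :
  computable a -> computable b -> K2_app a b c -> computable c.
Proof.
  intros [p Hp] [q Hq] H; exists (index (applyc (decode p) (decode q))).
  intros n; unfold Phi; rewrite decode_index; revert n.
  now apply (computes_applyc _ _ _ a b).
Qed.

(** * Tagged programs and the elements k, s, ka, sa, sab *)

Definition tagged (j : nat) (c : code) : code := Comp Left (Pair c (const j)).

Fixpoint height (c : code) : nat :=
  match c with Comp _ d => S (height d) | _ => 0 end.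

(** In [tagged j c] the component [d] is [const j], a j-fold composition, so its height is j. Thus j
    is readable from the syntax while the behaviour is that of [c]. *)
Definition tag (c : code) : nat :=
  match c with Comp _ (Pair _ d) => height d | _ => 0 end.

Lemma tag_tagged j c : tag (tagged j c) = j.
Proof. cbn; induction j as [|j IH]; [reflexivity|exact (f_equal S IH)]. Qed.

Lemma eval_tagged f j c x y : eval f (tagged j c) x y <-> eval f c x y.
Proof.
  cbn [tagged eval]; split.
  - intros (u & (v & w & Hv & _ & ->) & ->); now rewrite left_pair.
  - intros Hy; exists (pair_nat y j); split; [|now rewrite left_pair].
    exists y, j; split; [exact Hy|]; split; [|reflexivity].
    apply eval_den; [apply mu_free_const|now rewrite den_const].
Qed.

Definition cons (e : nat) (a : nat -> nat) (n : nat) : nat :=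
  match n with 0 => e | S i => a i end.

(** An element with this program maps its argument b to the element with index e and data b. *)
Definition consc (e : nat) : code := ifz idc (const e) (Comp queryr predc).

Lemma computes_consc e a b : computes (join a b) (consc e) (cons e b).
Proof.
  intros n; apply eval_den.
  - unfold consc, ifz; cbn [mu_free]; now rewrite mu_free_const.
  - unfold consc; rewrite den_ifz, den_idc, den_const; cbn [den].
    rewrite den_queryr, den_predc; now destruct n.
Qed.

Definition k1c : code := tagged 2 (Comp queryl Succ).

Definition kc : code := tagged 0 (consc (index k1c)).

(** The data of sab is the sequence of pairs <a(n), b(n)>, stored one place to the right because the
    index occupies place 0; the argument c is the right half of the oracle. *)
Definition s2c : code :=
  let ac := applyc (Comp Left (Comp queryl Succ)) queryr in
  let bc := applyc (Comp Right (Comp queryl Succ)) queryr in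
  tagged 4 (Comp Left (Pair (applyc ac bc) (Pair ac bc))).

(** At n + 1 the left oracle sa already holds a(n), being shifted by its index, whereas the argument
    b has to be read at the predecessor. *)
Definition s1c : code :=
  tagged 3 (ifz idc (const (index s2c)) (Pair queryl (Comp queryr predc))).

Definition sc : code := tagged 1 (consc (index s1c)).

Definition K2_elt (c : code) (a : nat -> nat) : K2 := cons (index c) a.

(** Zero data keeps the combinators computable, as the effective model requires. *)
Definition K2_k : K2 := K2_elt kc (fun _ => 0).
Definition K2_s : K2 := K2_elt sc (fun _ => 0).

Definition K2_rank (a : nat -> nat) : nat := tag (decode (a 0)).

Lemma rank_elt j c a : K2_rank (K2_elt (tagged j c) a) = j.
Proof.
  unfold K2_rank, K2_elt; cbn [cons]; now rewrite decode_index, tag_tagged.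
Qed.

Lemma K2_elt_inj c a b : K2_elt c a = K2_elt c b -> a = b.
Proof.
  intros H; apply functional_extensionality; intros n.
  exact (f_equal (fun g => g (S n)) H).
Qed.

Lemma app_elt j c a b g :
  @app K2 (K2_elt (tagged j c) a) b g <->
  computes (join (K2_elt (tagged j c) a) b) c g.
Proof.
  split; intros H n; specialize (H n);
    unfold Phi, K2_elt in *; cbn [cons] in *;
    rewrite decode_index in *; now apply eval_tagged in H || apply eval_tagged.
Qed.

Lemma app_k a : @app K2 K2_k a (K2_elt k1c a).
Proof. apply app_elt, computes_consc. Qed.

Lemma app_k1 a b : @app K2 (K2_elt k1c a) b a.
Proof.
  apply app_elt; intros n; apply eval_den; [reflexivity|].
  cbn [den]; now rewrite den_queryl.
Qed.

Lemma app_s a : @app K2 K2_s a (K2_elt s1c a).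
Proof. apply app_elt, computes_consc. Qed.

Lemma app_s1 a b :
  @app K2 (K2_elt s1c a) b (K2_elt s2c (fun n => pair_nat (a n) (b n))).
Proof.
  apply app_elt; intros n; apply eval_den.
  - unfold ifz; cbn [mu_free]; now rewrite mu_free_const.
  - rewrite den_ifz, den_idc, den_const; cbn [den].
    rewrite den_queryl, den_queryr, den_predc; unfold K2_elt.
    destruct n; cbn [cons pred]; reflexivity.
Qed.

(* The body of [s2c] also runs ac and bc at the argument, which makes sab c
   undefined whenever ac or bc is not total. *)
Lemma app_s2 a b c d :
  @app K2 (K2_elt s2c (fun n => pair_nat (a n) (b n))) c d <->
  exists ac bc, @app K2 a c ac /\ @app K2 b c bc /\ @app K2 ac bc d.
Proof.
  unfold s2c; cbv zeta; rewrite app_elt.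
  set (ab := K2_elt _ (fun n => pair_nat (a n) (b n))); set (f := join ab c).
  set (pa := Comp Left (Comp queryl Succ));
    set (pb := Comp Right (Comp queryl Succ)).
  assert (Ha : computes f pa a).
  { intros n; apply eval_den; [reflexivity|].
    unfold pa; cbn [den]; unfold f; rewrite den_queryl; symmetry; apply left_pair. }
  assert (Hb : computes f pb b).
  { intros n; apply eval_den; [reflexivity|].
    unfold pb; cbn [den]; unfold f; rewrite den_queryl; symmetry; apply right_pair. }
  assert (Hc : computes f queryr c).
  { intros n; apply eval_den; [reflexivity|].
    unfold f; now rewrite den_queryr. }
  split.
  - intros Hd.
    assert (H : forall n, exists uv,
      eval f (applyc pa queryr) n (fst uv) /\ eval f (applyc pb queryr) n (snd uv) /\
      eval f (applyc (applyc pa queryr) (applyc pb queryr)) n (d n)).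
    { intros n; destruct (Hd n) as (z & (w & z' & Hw & (u & v & Hu & Hv & _) & ->) & E).
      cbn [eval] in E; rewrite left_pair in E; subst w; now exists (u, v). }
    (* The values of ac and bc are known to exist only pointwise; description collects them into two
       sequences. *)
    set (uv n := proj1_sig (constructive_indefinite_description _ (H n))).
    assert (Huv : forall n,
      eval f (applyc pa queryr) n (fst (uv n)) /\
      eval f (applyc pb queryr) n (snd (uv n)) /\
      eval f (applyc (applyc pa queryr) (applyc pb queryr)) n (d n))
      by (intros n; exact (proj2_sig (constructive_indefinite_description _ (H n)))).
    exists (fun n => fst (uv n)), (fun n => snd (uv n)).
    assert (Hac : computes f (applyc pa queryr) (fun n => fst (uv n)))
      by (intros n; apply Huv).
    assert (Hbc : computes f (applyc pb queryr) (fun n => snd (uv n)))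
      by (intros n; apply Huv).
    split; [now apply (computes_applyc f pa queryr)|].
    split; [now apply (computes_applyc f pb queryr)|].
    apply (computes_applyc _ _ _ _ _ _ Hac Hbc); intros n; apply Huv.
  - intros (ac & bc & Hac & Hbc & Hd) n.
    apply (computes_applyc f pa queryr _ _ _ Ha Hc) in Hac.
    apply (computes_applyc f pb queryr _ _ _ Hb Hc) in Hbc.
    apply (computes_applyc _ _ _ _ _ _ Hac Hbc) in Hd.
    exists (pair_nat (d n) (pair_nat (ac n) (bc n))).
    split; [|symmetry; apply left_pair].
    exists (d n), (pair_nat (ac n) (bc n)); split; [apply Hd|].
    split; [|reflexivity]; exists (ac n), (bc n); auto.
Qed.

(** Application is single-valued, so ka, sa and sab are exactly the explicit elements above: the
    tags of their indices give the ranks, and their data gives back a and b. *)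
Lemma K2_unique_hnf : unique_hnf K2_k K2_s.
Proof.
  assert (Hk : forall a x, @app K2 K2_k a x -> x = K2_elt k1c a)
    by (intros a x H; exact (app_functional _ _ _ _ _ H (app_k a))).
  assert (Hs : forall a x, @app K2 K2_s a x -> x = K2_elt s1c a)
    by (intros a x H; exact (app_functional _ _ _ _ _ H (app_s a))).
  assert (Hs1 : forall a b x y, @app K2 K2_s a x -> @app K2 x b y ->
    y = K2_elt s2c (fun n => pair_nat (a n) (b n))).
  { intros a b x y Hx Hy; rewrite (Hs _ _ Hx) in Hy.
    exact (app_functional _ _ _ _ _ Hy (app_s1 a b)). }
  split.
  - intros a; exists (K2_elt k1c a); split; [apply app_k|apply app_k1].
  - intros a b; exists (K2_elt s1c a), (K2_elt s2c (fun n => pair_nat (a n) (b n))).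
    split; [apply app_s|]; split; [apply app_s1|apply app_s2].
  - exists K2_rank; split; [apply rank_elt|]; split; [apply rank_elt|].
    split; [intros a x H; rewrite (Hk _ _ H); apply rank_elt|].
    split; [intros a x H; rewrite (Hs _ _ H); apply rank_elt|].
    intros a b x y Hx Hy; rewrite (Hs1 _ _ _ _ Hx Hy); apply rank_elt.
  - intros a a' x Hx Hx'; apply (K2_elt_inj s1c).
    now rewrite <- (Hs _ _ Hx), <- (Hs _ _ Hx').
  - intros a b a' b' x x' y Hx Hy Hx' Hy'.
    assert (E : (fun n => pair_nat (a n) (b n)) = (fun n => pair_nat (a' n) (b' n))).
    { apply (K2_elt_inj s2c).
      now rewrite <- (Hs1 _ _ _ _ Hx Hy), <- (Hs1 _ _ _ _ Hx' Hy'). }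
    split; apply functional_extensionality; intros n;
      apply (f_equal (fun g => g n)) in E.
    + now apply (f_equal left_nat) in E; rewrite !left_pair in E.
    + now apply (f_equal right_nat) in E; rewrite !right_pair in E.
Qed.

(** * The effective model *)

Lemma computable_elt c : computable (K2_elt c (fun _ => 0)).
Proof.
  exists (index (ifz idc (const (index c)) Zero)); intros n.
  unfold Phi; rewrite decode_index; apply eval_den.
  - unfold ifz; cbn [mu_free]; now rewrite mu_free_const.
  - rewrite den_ifz, den_idc, den_const; now destruct n.
Qed.

Lemma K2eff_eq (a b : K2eff) : proj1_sig a = proj1_sig b -> a = b.
Proof. destruct a, b; apply subset_eq_compat. Qed.

(** Everything restricts from the full model, because a defined application of computable elements
    has a computable value. In the s-clause this makes ac and bc available as elements of the
    effective model. *)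
Lemma K2eff_unique_hnf :
  @unique_hnf K2eff (exist _ K2_k (computable_elt kc)) (exist _ K2_s (computable_elt sc)).
Proof.
  destruct K2_unique_hnf as [Hk Hs (rank & H0 & H1 & H2 & H3 & H4) Hs1 Hs2].
  assert (lift : forall (a b : K2eff) (c : K2),
    @app K2 (proj1_sig a) (proj1_sig b) c ->
    exists c' : K2eff, proj1_sig c' = c /\ app a b c').
  { intros [a Ha] [b Hb] c H.
    now exists (exist _ c (K2_app_computable _ _ _ Ha Hb H)). }
  set (k := exist _ K2_k _ : K2eff); set (s := exist _ K2_s _ : K2eff).
  split.
  - intros a; destruct (Hk (proj1_sig a)) as (x & Hx & Hxb).
    destruct (lift k a x Hx) as (x' & <- & Hx'); exists x'; split; [exact Hx'|].
    intros b; apply Hxb.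
  - intros a b; destruct (Hs (proj1_sig a) (proj1_sig b)) as (x & y & Hx & Hy & H).
    destruct (lift s a x Hx) as (x' & <- & Hx').
    destruct (lift x' b y Hy) as (y' & <- & Hy').
    exists x', y'; split; [exact Hx'|]; split; [exact Hy'|].
    intros c d; split.
    + intros Hd; apply H in Hd as (ac & bc & Hac & Hbc & Hd).
      destruct (lift a c ac Hac) as (ac' & <- & Hac').
      destruct (lift b c bc Hbc) as (bc' & <- & Hbc').
      now exists ac', bc'.
    + intros (ac & bc & Hac & Hbc & Hd); apply H.
      now exists (proj1_sig ac), (proj1_sig bc).
  - exists (fun a => rank (proj1_sig a)).
    split; [exact H0|]; split; [exact H1|].
    split; [intros a x; apply H2|]; split; [intros a x; apply H3|].
    intros a b x y; apply H4.
  - intros a a' x Hx Hx'; apply K2eff_eq; exact (Hs1 _ _ _ Hx Hx').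
  - intros a b a' b' x x' y Hx Hy Hx' Hy'.
    destruct (Hs2 _ _ _ _ _ _ _ Hx Hy Hx' Hy'); auto using K2eff_eq.
Qed.

Theorem theorem3p3 : strongly_completable K2 /\ strongly_completable K2eff.
Proof.
  split.
  - exact (unique_hnf_strongly_completable K2_unique_hnf).
  - exact (unique_hnf_strongly_completable K2eff_unique_hnf).
Qed.
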